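(* Let $n,m,k,l\in\mathbb{Z}^+$ and $L\in\mathsf{NExt}(\mathsf{S4BP}^{k,\omega}_{n,m})$. Then $L$ is Kripke complete. Moreover, if $L\in\mathsf{NExt}(\mathsf{S4BP}^{k,l}_{n,m})$, then $L$ has the finite model property.
   Context: Tense formulas use $\Box$, $\Diamond=\neg\Box\neg$ and a past possibility operator written here $\mathsf{P}$; $\mathsf{S4}_t=\mathsf{K}_t\oplus\{\Box p\to p,\Box p\to\Box\Box p\}$; $\mathsf{NExt}(L)$ is the set of tense logics extending $L$. With $\Delta\phi=\phi\vee\Diamond\phi\vee\mathsf{P}\phi$, $\Delta^{j+1}\phi=\Delta\Delta^j\phi$: $\mathbf{bz}_l=\Delta^{l+1}p\to\Delta^lp$, $\mathbf{bz}_\omega=\top$; $\mathbf{bw}^+_n=\bigwedge_{i\leq n}\Diamond p_i\to\bigvee_{i\neq j\leq n}\Diamond(p_i\wedge(p_j\vee\Diamond p_j))$; $\mathbf{bw}^-_m$ the same with $\mathsf{P}$ for $\Diamond$; $\mathbf{bd}_1=\Diamond\Box p_0\to p_0$, $\mathbf{bd}_{j+1}=\Diamond(\Box p_j\wedge\neg\mathbf{bd}_j)\to p_j$. $\mathsf{S4BP}^{k,l}_{n,m}=\mathsf{S4}_t\oplus\{\mathbf{bd}_k,\mathbf{bz}_l,\mathbf{bw}^+_n,\mathbf{bw}^-_m\}$. $L$ is Kripke complete if it is the logic of a class of Kripke frames, and has the finite model property if it is the logic of a class of finite frames. *)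

(* Defs.v *)
From mathcomp Require Import all_boot all_classical.

Set Implicit Arguments.
Unset Strict Implicit.
Unset Printing Implicit Defensive.

Local Open Scope classical_set_scope.

Declare Scope tense_scope.
Delimit Scope tense_scope with tense.

(* [Past] is the past possibility operator: true at a world when its argument
   holds at some predecessor. *)
Inductive form : Type :=
  | Var of nat
  | Bot
  | Imp of form & form
  | Box of form
  | Past of form.

Bind Scope tense_scope with form.

Definition Neg (a : form) : form := Imp a Bot.
Definition Top : form := Neg Bot.
Definition Or (a b : form) : form := Imp (Neg a) b.
Definition And (a b : form) : form := Neg (Imp a (Neg b)).
Definition Dia (a : form) : form := Neg (Box (Neg a)).

Notation "a ⊃ b" := (Imp a b) (at level 55, right associativity) : tense_scope.
Notation "a ⊔ b" := (Or a b) (at level 50, left associativity) : tense_scope.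
Notation "a ⊓ b" := (And a b) (at level 45, left associativity) : tense_scope.
Notation "¬ a" := (Neg a) (at level 35, right associativity) : tense_scope.
Notation "□ a" := (Box a) (at level 35, right associativity) : tense_scope.
Notation "◇ a" := (Dia a) (at level 35, right associativity) : tense_scope.

Local Open Scope tense_scope.

Fixpoint subst (s : nat -> form) (a : form) : form :=
  match a with
  | Var i => s i
  | Bot => Bot
  | Imp b c => subst s b ⊃ subst s c
  | Box b => □ (subst s b)
  | Past b => Past (subst s b)
  end.

(* Boolean evaluation treating variables and modalized subformulas as atoms;
   the formulas true under all such evaluations are exactly the substitution
   instances of classical propositional tautologies. *)
Fixpoint bool_eval (v : form -> bool) (a : form) : bool :=
  match a with
  | Bot => false
  | Imp b c => bool_eval v b ==> bool_eval v c
  | _ => v a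
  end.

Definition tautology_instance (a : form) : Prop := forall v, bool_eval v a.

(* Residuation of [Past] and [Box] gives, together with the other clauses, the
   K axioms and necessitation for □ and for its past counterpart ¬ Past ¬, and
   the converse axioms p ⊃ □ Past p and p ⊃ ¬ Past ¬ ◇ p; conversely it is
   derivable from them and the equivalence of Past p and Past ¬ ¬ p. *)
Record tense_logic (L : set form) : Prop := TenseLogic {
  tl_taut : forall a, tautology_instance a -> L a;
  tl_residuation : forall a b, L (Past a ⊃ b) <-> L (a ⊃ □ b);
  tl_mp : forall a b, L (a ⊃ b) -> L a -> L b;
  tl_subst : forall s a, L a -> L (subst s a)
}.

Definition Kt : set form := smallest tense_logic set0.

Definition oplus (L S : set form) : set form := smallest tense_logic (L `|` S).

Definition NExt (L0 : set form) : set (set form) :=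
  [set L | tense_logic L /\ L0 `<=` L].

Definition S4t : set form :=
  oplus Kt [set □ Var 0 ⊃ Var 0; □ Var 0 ⊃ □ □ Var 0].

Definition Delta (a : form) : form := a ⊔ ◇ a ⊔ Past a.

(* [None] stands for ω. *)
Definition bz (l : option nat) : form :=
  match l with
  | Some l => iter l.+1 Delta (Var 0) ⊃ iter l Delta (Var 0)
  | None => Top
  end.

(* The variables are p_0, ..., p_n, hence n + 1 conjuncts; [M] is [Dia] for the
   forward and [Past] for the backward width formula. *)
Definition bw (M : form -> form) (n : nat) : form :=
  \big[And/Top]_(i < n.+1) M (Var i) ⊃
  \big[Or/Bot]_(i < n.+1) \big[Or/Bot]_(j < n.+1 | i != j)
    M (Var i ⊓ (Var j ⊔ M (Var j))).

Definition bw_plus : nat -> form := bw Dia.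
Definition bw_minus : nat -> form := bw Past.

(* Meaningful for positive indices only; [bd 0] is a dummy value. *)
Fixpoint bd (k : nat) : form :=
  match k with
  | 0 => Bot
  | 1 => ◇ □ Var 0 ⊃ Var 0
  | j.+1 => ◇ (□ Var j ⊓ ¬ bd j) ⊃ Var j
  end.

Definition S4BP (k : nat) (l : option nat) (n m : nat) : set form :=
  oplus S4t [set bd k; bz l; bw_plus n; bw_minus m].

Record kframe : Type := KFrame {
  world :> Type;
  acc : world -> world -> Prop;
  world_inhabited : inhabited world
}.

Fixpoint sat (F : kframe) (V : nat -> set F) (w : F) (a : form) : Prop :=
  match a with
  | Var i => V i w
  | Bot => False
  | Imp b c => sat V w b -> sat V w c
  | Box b => forall u, acc w u -> sat V u b
  | Past b => exists2 u, acc u w & sat V u b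
  end.

Definition valid (F : kframe) (a : form) : Prop :=
  forall (V : nat -> set F) (w : F), sat V w a.

Definition Log (C : set kframe) : set form :=
  [set a | forall F, C F -> valid F a].

Definition kripke_complete (L : set form) : Prop :=
  exists C : set kframe, L = Log C.

Definition finite_model_property (L : set form) : Prop :=
  exists2 C : set kframe,
    (forall F, C F -> finite_set [set: world F]) & L = Log C.

(* Main.v *)
(* For a non-theorem c of L, take the canonical model of L over the finitely
   many variables of c. Two points of one cluster that agree on these variables
   are bisimilar, hence equal, so clusters are finite; with bd_k and the two
   width axioms every point then sees, and is seen by, finitely many points.
   The truth of a formula at a point therefore depends on finitely many points
   only. Distinct points are separated by formulas, so on a finite set every
   valuation agrees with a definable one, and the underlying Kripke frame
   validates L. Finally bz_l confines each connected component to the ball of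
   radius l around any of its points, which is finite. *)

Require Import Defs.
From mathcomp Require Import all_boot all_classical.

Set Implicit Arguments.
Unset Strict Implicit.
Unset Printing Implicit Defensive.

Local Open Scope classical_set_scope.
Local Open Scope tense_scope.

(** * Finiteness from finite clusters, bounded width and bounded depth *)

Section WidthDepth.
Variables (T : Type) (R : T -> T -> Prop).
Hypothesis finite_cluster : forall x, finite_set [set y | R x y /\ R y x].

Definition width_le (n : nat) (A : set T) : Prop :=
  forall f : nat -> T, (forall i, i <= n -> A (f i)) ->
  exists i j, [/\ i <= n, j <= n, i != j & R (f i) (f j)].

(** Chains have [k.+1] entries and are listed downwards from the top point [c 0], the direction in
    which [bd] nests. *)
Definition depth_le (k : nat) (A : set T) : Prop :=
  forall c : nat -> T, (forall i, i <= k -> A (c i)) ->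
  ~ (forall i, i < k -> R (c i.+1) (c i) /\ ~ R (c i) (c i.+1)).

Definition maximal_points (A : set T) : set T :=
  [set x | A x /\ forall y, A y -> R x y -> R y x].

(** Any relation between maximal points is mutual. From infinitely many of them, points can be
    picked one by one outside the finitely many finite clusters already met, giving antichains of
    every length. *)
Lemma finite_maximal_points (n : nat) (A : set T) :
  width_le n A -> finite_set (maximal_points A).
Proof.
move=> wA; apply: contrapT => infM.
suff anti r : exists f : nat -> T, (forall i, i < r -> maximal_points A (f i)) /\
    forall i j, i < r -> j < r -> i != j -> ~ R (f i) (f j).
  have [f [fM fR]] := anti n.+1.
  have [i [j [il jl ij Rij]]] := wA f (fun i il => (fM i il).1).
  exact: fR Rij.
elim: r => [|r [f [fM fR]]].
  by have [x _] := infinite_setN0 infM; exists (fun=> x).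
have fin : finite_set (\bigcup_(i in `I_r) [set y | R (f i) y /\ R y (f i)]).
  by apply: bigcup_finite => // ; exact: finite_II.
have [x [xM xf]] := infinite_setN0 (infinite_setD infM fin).
have xf1 i : i < r -> ~ R (f i) x.
  move=> ir Rfx; apply: xf; exists i => //; split=> //.
  by apply: (fM i ir).2 => //; exact: xM.1.
have xf2 i : i < r -> ~ R x (f i).
  move=> ir Rxf; apply: xf; exists i => //; split=> //.
  by apply: xM.2 => //; exact: (fM i ir).1.
exists (fun i => if i == r then x else f i); split=> [i|i j].
  rewrite ltnS leq_eqVlt; case: eqP => //= _; exact: fM.
rewrite (ltnS i) (ltnS j) (leq_eqVlt i) (leq_eqVlt j).
have [->|_] := eqVneq i r; have [->|_] := eqVneq j r.
- by move=> _ _ /negP[].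
- by move=> _ jr _; exact: xf2.
- by move=> ir _ _; exact: xf1.
- exact: fR.
Qed.

(** Induction on [k]: the maximal points are finite in number, and removing them lowers the depth by
    one. *)
Lemma finite_of_width_depth (n k : nat) (A : set T) :
  width_le n A -> depth_le k A -> finite_set A.
Proof.
elim: k A => [|k IHk] A wA dA.
  suff -> : A = set0 by exact: finite_set0.
  by apply/seteqP; split=> // x Ax; apply: (dA (fun=> x)).
have -> : A = maximal_points A `|` (A `\` maximal_points A).
  apply/seteqP; split=> [x Ax|x [[]|[]]//].
  by case: (pselect (maximal_points A x)); [left|right].
rewrite finite_setU; split; first exact: finite_maximal_points wA.
apply: IHk => [f fA|c cA cR]; first by apply: wA => i /fA[].
(* The top [c 0] of a chain of non-maximal points lies strictly below some [d] in [A]; putting [d]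
   in front makes the chain too long for [A]. *)
have [Ac0 /not_andP[//|]] := cA 0 (leq0n k).
move=> /existsNP[d] /not_implyP[Ad] /not_implyP[Rcd Rdc].
apply: (dA (fun i => if i is j.+1 then c j else d)) => [[|i]|[|i]] //.
- by move=> /cA[].
- exact: cR.
Qed.

End WidthDepth.

(** * Maximal consistent theories and their existence *)

Definition complete_theory (N w : set form) : Prop :=
  [/\ N `<=` w, ~ w Bot & forall a b, w (a ⊃ b) <-> (w a -> w b)].

Section Lindenbaum.
Variables (N T : set form) (c : form).
Hypotheses (taut : forall a, tautology_instance a -> N a) (NT : N `<=` T)
  (mp : forall a b, T (a ⊃ b) -> T a -> T b) (Tc : ~ T c).

(** Zorn's lemma among the sets closed under modus ponens that omit [c]. [T] is separate from [N]
    because the modal witnesses below start from sets read off a single world. *)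
Lemma lindenbaum : exists w, [/\ complete_theory N w, T `<=` w & ~ w c].
Proof.
pose good U := (forall a b, U (a ⊃ b) -> U a -> U b) /\ ~ U c.
(* The union with [T] is part of the property so that it also holds for the empty chain, whose union
   is empty. *)
have [F Fgood Ftot|A [[mpA Ac] maxA]] :=
    @Zorn_bigcup _ (fun A => good (T `|` A)).
  split=> [a b|[//|[A /Fgood[_ cA] Ac]]]; last by apply: cA; right.
  have mpF A : F A -> (T `|` A) (a ⊃ b) -> (T `|` A) a ->
      (T `|` \bigcup_(X in F) X) b.
    move=> FA ab aA; have [+ _] := Fgood _ FA => /(_ _ _ ab aA)[|Ab]; first by left.
    by right; exists A.
  move=> [Tab|[A FA Aab]] [Ta|[B FB Ba]].
  - by left; exact: mp Ta.
  - by apply: (mpF B FB); [left|right].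
  - by apply: (mpF A FA); [right|left].
  - have [AB|BA] := Ftot _ _ FA FB.
    + by apply: (mpF B FB); right=> //; exact: AB.
    + by apply: (mpF A FA); right=> //; exact: BA.
set U := T `|` A in mpA Ac maxA.
have Ut a : tautology_instance a -> U a by move=> /taut/NT; left.
have UN a : ~ U a -> U (a ⊃ c).
  move=> Ua; apply: contrapT => Uac.
  (* If both [a] and [a ⊃ c] were outside [U], the consequences of [a] over [U] would form a
     strictly larger good set. *)
  pose B : set form := [set b | U (a ⊃ b)].
  have UB : U `<=` B.
    move=> b Ub; apply: mpA Ub; apply: Ut => v /=.
    by case: (bool_eval v a); case: (bool_eval v b).
  have TB : T `|` B = B by apply/setUidPr => b Tb; apply: UB; left.
  apply: (maxA B).
    split=> [b Ab|BA]; first by apply: UB; right.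
    apply: Ua; right; apply: BA; apply: Ut => v /=.
    by case: (bool_eval v a).
  rewrite TB; split=> // p q Bpq Bp.
  apply: (mpA _ _ (mpA _ _ _ Bpq) Bp); apply: Ut => v /=.
  by case: (bool_eval v a); case: (bool_eval v p); case: (bool_eval v q).
exists U; split=> //; last by left.
split=> [a /NT|UBot|a b]; first by left.
- by apply: Ac; apply: mpA UBot; apply: Ut => v.
- split; first exact: mpA.
  move=> Uab; apply: contrapT => nUab.
  case: (pselect (U a)) => [/Uab Ub|/UN Uac].
    apply: nUab; apply: mpA Ub; apply: Ut => v /=.
    by case: (bool_eval v a); case: (bool_eval v b).
  apply: Ac; apply: (mpA _ _ (mpA _ _ _ (UN _ nUab)) Uac); apply: Ut => v /=.
  by case: (bool_eval v a); case: (bool_eval v b); case: (bool_eval v c).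
Qed.

End Lindenbaum.

(** * The canonical model *)

Section Canonical.
Variable N : set form.
Hypotheses (taut : forall a, tautology_instance a -> N a)
  (residuation : forall a b, N (Past a ⊃ b) <-> N (a ⊃ □ b))
  (mp : forall a b, N (a ⊃ b) -> N a -> N b).

(* Written [form -> Prop] because [set form] lives in a universe too large for
   [world]. *)
Definition canonical_frame
    (w0 : inhabited {w : form -> Prop | complete_theory N w}) : kframe :=
  @KFrame {w : form -> Prop | complete_theory N w}
    (fun w u => forall a, sval w (□ a) -> sval u a) w0.

Lemma imp_trans b a c : N (a ⊃ b) -> N (b ⊃ c) -> N (a ⊃ c).
Proof.
move=> Nab Nbc; apply: (mp (mp _ Nab) Nbc); apply: taut => v /=.
by case: (bool_eval v a); case: (bool_eval v b); case: (bool_eval v c).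
Qed.

Lemma imp_past a b : N (a ⊃ b) -> N (Past a ⊃ Past b).
Proof.
move=> Nab; apply/residuation; apply: imp_trans Nab _.
by apply/residuation; apply: taut => v /=; case: (v _).
Qed.

Lemma past_box a : N (Past (□ a) ⊃ a).
Proof. by apply/residuation; apply: taut => v /=; case: (v _). Qed.

Lemma box_past a : N (a ⊃ □ (Past a)).
Proof. by apply/residuation; apply: taut => v /=; case: (v _). Qed.

(** Residuation makes [Box] a right adjoint, so it preserves conjunctions and consequences: [Past P]
    implies both [a ⊃ b] and [a], hence [b]. Dually, [past_or] holds because [Past] is a left
    adjoint. *)
Lemma box_K a b : N (□ (a ⊃ b) ⊃ □ a ⊃ □ b).
Proof.
pose P := (□ (a ⊃ b) ⊓ □ a).
have PL : N (P ⊃ □ (a ⊃ b)).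
  by apply: taut => v /=; case: (v _); case: (v _).
have PR : N (P ⊃ □ a).
  by apply: taut => v /=; case: (v _); case: (v _).
have QL : N (Past P ⊃ (a ⊃ b)) by apply/residuation.
have QR : N (Past P ⊃ a) by apply/residuation.
have : N (P ⊃ □ b).
  apply/residuation; apply: (mp (mp _ QL) QR); apply: taut => v /=.
  by case: (v (Past P)); case: (bool_eval v a); case: (bool_eval v b).
by apply: mp; apply: taut => v /=; do 3 case: (v _).
Qed.

Lemma past_or a b : N (Past (a ⊔ b) ⊃ Past a ⊔ Past b).
Proof.
pose Q := Past a ⊔ Past b.
have QL : N (a ⊃ □ Q).
  by apply/residuation; apply: taut => v /=; case: (v _).
have QR : N (b ⊃ □ Q).
  by apply/residuation; apply: taut => v /=; case: (v _); case: (v _).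
apply/residuation; apply: (mp (mp _ QL) QR); apply: taut => v /=.
by case: (bool_eval v a); case: (bool_eval v b); case: (v _).
Qed.

Section Worlds.
Variable w : set form.
Hypothesis cw : complete_theory N w.

Lemma theory_mp a b : N (a ⊃ b) -> w a -> w b.
Proof. by case: cw => Nw _ imp /Nw/imp. Qed.

Lemma theory_neg a : w (¬ a) <-> ~ w a.
Proof.
case: cw => _ bot imp; split=> [/imp wa /wa //|wa].
by apply/imp => /wa.
Qed.

Lemma theory_or a b : w (a ⊔ b) <-> w a \/ w b.
Proof.
have [_ _ imp] := cw; split=> [/imp wab|wab].
  by case: (pselect (w a)) => [|/theory_neg/wab]; [left|right].
by apply/imp => /theory_neg; case: wab.
Qed.

End Worlds.

Lemma box_witness w b : complete_theory N w -> ~ w (□ b) ->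
  exists u, [/\ complete_theory N u, forall a, w (□ a) -> u a & ~ u b].
Proof.
move=> cw wb; apply: (@lindenbaum N [set c | w (□ c)] b) => // [a Na|a c wac wa].
  (* Necessitation comes from residuation: [a] gives [Past Top ⊃ a], hence [Top ⊃ □ a]. *)
  have [Nw _ _] := cw; apply: Nw; apply: (mp (a := Top)); last by apply: taut.
  by apply/residuation; apply: mp Na; apply: taut => v /=;
    case: (bool_eval v a); case: (v _).
have [_ _ imp] := cw; have /imp wabox : w (□ a ⊃ □ c); last exact: wabox.
exact: theory_mp (box_K a c) wac.
Qed.

Lemma past_witness u b : complete_theory N u -> u (Past b) ->
  exists w, [/\ complete_theory N w, forall a, w (□ a) -> u a & w b].
Proof.
move=> cu ub; have neg := theory_neg cu.
have monot a c : (forall v, bool_eval v a -> bool_eval v c) ->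
    u (Past a) -> u (Past c).
  move=> ac; apply: theory_mp => //; apply: imp_past; apply: taut => v.
  by apply/implyP; exact: ac.
(* The starting set consists of what [u] forces at all predecessors satisfying [b]. It contains [b],
   and it contains [¬ □ a] for every [a] false at [u]; [past_or] gives closure under modus
   ponens. *)
have [||||w [cw Tw _]] := @lindenbaum N [set c | ~ u (Past (b ⊓ ¬ c))] Bot.
- exact: taut.
- move=> c Nc /=; apply/neg; apply: (theory_mp cu (a := Top)); last first.
    by apply/neg; case: cu.
  have : N (Past (b ⊓ ¬ c) ⊃ Bot).
    apply/residuation; apply: mp Nc; apply: taut => v /=.
    by case: (bool_eval v c); case: (bool_eval v b).
  by apply: mp; apply: taut => v /=; case: (v _).
- move=> a c /= ac aT uc.
  have : u (Past ((b ⊓ ¬ (a ⊃ c)) ⊔ (b ⊓ ¬ a))).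
    apply: monot uc => v /=.
    by case: (bool_eval v a); case: (bool_eval v b); case: (bool_eval v c).
  by move=> /(theory_mp cu (past_or _ _))/(theory_or cu)[].
- by apply; apply: monot ub => v /=; case: (bool_eval v b).
exists w; split=> // [a wa|].
  apply: (theory_mp cu (past_box a)); apply: contrapT => ua.
  have /(theory_neg cw) : w (¬ □ a); last by apply.
  apply: Tw => /= uba; apply: ua; apply: monot uba => v /=.
  by case: (bool_eval v b); case: (v _).
apply: Tw => /= ub'; have [_ ubot _] := cu; apply: ubot; apply: theory_mp ub' => //.
apply/residuation; apply: taut => v /=.
by case: (bool_eval v b).
Qed.

(** The truth lemma; [box_witness] and [past_witness] supply its modal cases. *)
Lemma canonical_sat w0 (x : canonical_frame w0) a :
  sat (fun i => [set w : canonical_frame w0 | sval w (Var i)]) x a <-> sval x a.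
Proof.
elim: a x => [i||a IHa b IHb|a IHa|a IHa] //= x; have [Nx bot imp] := svalP x.
- by split.
- by rewrite imp IHa IHb.
- split=> [xa|xa u xu]; last by apply/IHa/xu.
  apply: contrapT => /(box_witness (svalP x))[u [cu xu ua]].
  by apply: ua; apply/(IHa (exist _ u cu))/xa.
- split=> [[[u cu] ux /IHa ua]|/(past_witness (svalP x))[u [cu ux ua]]].
    by apply: ux; apply: (theory_mp cu (box_past a)); exact: ua.
  by exists (exist _ u cu) => //; apply/IHa.
Qed.

End Canonical.

Lemma finite_set_ind (T : Type) (P : set T -> Prop) :
  P set0 -> (forall x A, P A -> P (x |` A)) -> forall A, finite_set A -> P A.
Proof.
move=> P0 PU A /(@finite_seqP {classic T})[r ->].
elim: r => [|x r IHr]; first by rewrite set_nil.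
suff -> : [set` x :: r] = x |` [set` r] by exact: PU.
apply/seteqP; split=> y /=; rewrite inE; first by move/predU1P.
by move=> xy; exact/predU1P.
Qed.

(** * Satisfaction and its locality *)

Section Satisfaction.
Variable F : kframe.
Implicit Types (V : nat -> set F) (w : F).

Lemma sat_subst V w s a :
  sat V w (subst s a) <-> sat (fun i => [set x | sat V x (s i)]) w a.
Proof.
elim: a w => [i||a IHa b IHb|a IHa|a IHa] w //=.
- by rewrite IHa IHb.
- by split=> H u wu; apply/IHa/H.
- by split=> -[u uw ua]; exists u => //; apply/IHa.
Qed.

Lemma sat_or V w a b : sat V w (a ⊔ b) <-> sat V w a \/ sat V w b.
Proof.
split=> [/= ab|[wa /(_ wa)|wb]] //.
by case: (pselect (sat V w a)) => [|/ab]; [left|right].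
Qed.

Lemma sat_and V w a b : sat V w (a ⊓ b) <-> sat V w a /\ sat V w b.
Proof.
split=> [/= ab|[wa wb] /(_ wa wb)] //.
by split; apply: contrapT => nab; apply: ab.
Qed.

Lemma sat_dia V w a : sat V w (◇ a) <-> exists2 u, acc w u & sat V u a.
Proof.
split=> [/= wa|[u wu ua] /(_ _ wu ua)] //.
by apply: contrapT => nu; apply: wa => u wu ua; apply: nu; exists u.
Qed.

Lemma sat_bigand (I : finType) (P : pred I) (f : I -> form) V w :
  sat V w (\big[And/Top]_(i | P i) f i) <-> forall i, P i -> sat V w (f i).
Proof.
suff H (r : seq I) : sat V w (\big[And/Top]_(i <- r | P i) f i) <->
    forall i, i \in r -> P i -> sat V w (f i).
  by rewrite H; split=> [h i|h i _]; apply: h; rewrite mem_index_enum.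
elim: r => [|i r IHr]; first by rewrite big_nil; split=> // _; exact.
rewrite big_cons; case: ifP => Pi; rewrite ?sat_and IHr; split.
- by move=> [wi h] j /[!inE]/predU1P[->|/h].
- by move=> h; split=> [|j jr]; apply: h => //; rewrite inE ?eqxx ?jr ?orbT.
- by move=> h j /[!inE]/predU1P[->|/h]//; rewrite Pi.
- by move=> h j jr; apply: h; rewrite inE jr orbT.
Qed.

Lemma sat_bigor (I : finType) (P : pred I) (f : I -> form) V w :
  sat V w (\big[Or/Bot]_(i | P i) f i) -> exists2 i, P i & sat V w (f i).
Proof.
elim/big_rec: _ => // i a Pi IHa /sat_or[wi|/IHa//].
by exists i.
Qed.

(** The relation [S] stands for [acc] or its converse, so that [bw_plus] and [bw_minus] are treated
    together. *)
Lemma sat_bw (M : form -> form) (S : F -> F -> Prop) V w n :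
  (forall u a, sat V u (M a) <-> exists2 v, S u v & sat V v a) ->
  sat V w (bw M n) ->
  (forall i, i <= n -> exists2 u, S w u & V i u) ->
  exists i j, [/\ i <= n, j <= n, i != j &
    exists2 u, S w u & V i u /\ (V j u \/ exists2 v, S u v & V j v)].
Proof.
move=> satM wbw Vw.
have /wbw/sat_bigor[i _ /sat_bigor[j ij /satM[u wu]]] :
    sat V w (\big[And/Top]_(i < n.+1) M (Var i)).
  by apply/sat_bigand => i _; apply/satM; apply: Vw; rewrite -ltnS.
move=> /sat_and[ui uj]; exists i, j; split; rewrite -1?ltnS //.
exists u => //; split=> //.
by move: uj => /sat_or[|/satM]; [left|right].
Qed.

(** The worlds at which the valuation can influence the truth of [a] at [w]: the ends of the paths
    traced by the modal nesting of [a]. *)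
Fixpoint relevant (w : F) (a : form) : set F :=
  match a with
  | Var _ => [set w]
  | Bot => set0
  | Imp b c => relevant w b `|` relevant w c
  | Box b => \bigcup_(u in [set u | acc w u]) relevant u b
  | Past b => \bigcup_(u in [set u | acc u w]) relevant u b
  end.

Lemma eq_sat V V' a w : (forall i x, relevant w a x -> V i x <-> V' i x) ->
  sat V w a <-> sat V' w a.
Proof.
elim: a w => [i||a IHa b IHb|a IHa|a IHa] w //= VV'.
- exact: VV'.
- rewrite (IHa w); last by move=> i x wx; apply: VV'; left.
  by rewrite (IHb w) // => i x wx; apply: VV'; right.
- have H u : acc w u -> sat V u a <-> sat V' u a.
    by move=> wu; apply: IHa => i x ux; apply: VV'; exists u.
  by split=> wa u wu; apply/H => //; exact: wa.
- have H u : acc u w -> sat V u a <-> sat V' u a.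
    by move=> wu; apply: IHa => i x ux; apply: VV'; exists u.
  by split=> -[u uw ua]; exists u => //; apply/H.
Qed.

Definition locally_finite : Prop := forall w : F,
  finite_set [set u | acc w u] /\ finite_set [set u | acc u w].

Lemma finite_relevant w a : locally_finite -> finite_set (relevant w a).
Proof.
move=> lfin; elim: a w => [i||a IHa b IHb|a IHa|a IHa] w /=.
- exact: finite_set1.
- exact: finite_set0.
- by rewrite finite_setU.
- by apply: bigcup_finite => //; exact: (lfin w).1.
- by apply: bigcup_finite => //; exact: (lfin w).2.
Qed.

End Satisfaction.

(** * Refined models and the validity of [L] on their frames *)

(** [rm_eq] is differentiatedness and [rm_acc] tightness. [rm_sat] concerns the one valuation [V],
    so validity on the frame remains to be shown; [rm_var] leaves only the first [s] variables to
    tell points apart inside a cluster. *)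
Record refined_model (L : set form) (s : nat) (F : kframe) (V : nat -> set F) :
    Prop := RefinedModel {
  rm_sat : forall a w, L a -> sat V w a;
  rm_eq : forall x y, (forall a, sat V x a <-> sat V y a) -> x = y;
  rm_acc : forall x y, (forall a, sat V x (□ a) -> sat V y a) -> acc x y;
  rm_var : forall i x, s <= i -> ~ V i x
}.

Fixpoint var_bound (a : form) : nat :=
  match a with
  | Var i => i.+1
  | Bot => 0
  | Imp b c => maxn (var_bound b) (var_bound c)
  | Box b => var_bound b
  | Past b => var_bound b
  end.

Lemma subst_id s a : (forall i, i < var_bound a -> s i = Var i) -> subst s a = a.
Proof.
elim: a => [i||a IHa b IHb|a IHa|a IHa] //= sV; first exact: sV.
- by rewrite IHa ?IHb // => i ia; apply: sV; rewrite leq_max ia ?orbT.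
- by rewrite IHa.
- by rewrite IHa.
Qed.

Lemma exists_refined_model (L : set form) (c : form) : tense_logic L -> ~ L c ->
  exists F V w, refined_model L (var_bound c) V /\ ~ @sat F V w c.
Proof.
move=> [taut resid mp Lsubst] Lc; pose s := var_bound c.
(* Replacing all variables from [s] on by [Bot] leaves [c] unchanged and makes them false in the
   canonical model of [N]. [N] is in general not closed under substitution, but [L] is contained in
   it. *)
pose sigma i := if i < s then Var i else Bot.
pose N : set form := [set a | L (subst sigma a)].
have tautN a : tautology_instance a -> N a by move=> /taut; exact: Lsubst.
have residN a b : N (Past a ⊃ b) <-> N (a ⊃ □ b) by exact: resid.
have mpN a b : N (a ⊃ b) -> N a -> N b by exact: mp.
have [||||w [cw _ wc]] := @lindenbaum N N c => //.
  by rewrite /N /= subst_id // => i; rewrite /sigma => ->.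
pose F := canonical_frame (inhabits (exist _ w cw)).
exists F, (fun i => [set w : F | sval w (Var i)]), (exist _ w cw).
split; last by move=> /(canonical_sat tautN residN mpN).
have satE (x : F) a := canonical_sat tautN residN mpN x a.
split=> [a x La|[x cx] [y cy] xy|x y xy a|i [x cx] si /= xi].
- by apply/satE; have [Nx _ _] := svalP x; apply: Nx; exact: Lsubst.
- apply: eq_exist; apply/funext => a; apply/propext.
  by have := xy a; rewrite !satE.
- by move=> /satE/xy/satE.
- have [Nx botx _] := cx; apply/botx.
  apply: (theory_mp cx (a := Var i)) xi.
  by rewrite /N /= /sigma ltnNge si; apply: taut.
Qed.

Section RefinedModel.
Variables (L : set form) (s : nat) (F : kframe) (V : nat -> set F).
Hypotheses (tlL : tense_logic L) (S4L : S4t `<=` L) (rmV : refined_model L s V).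
Local Notation R := (@acc F).

(** By closure under substitution, [L] holds under every valuation definable by formulas in the
    model. *)
Lemma sat_instance (a : form) (f : nat -> form) (w : F) :
  L a -> sat (fun i => [set x | sat V x (f i)]) w a.
Proof. by move=> La; apply/sat_subst/(rm_sat rmV)/(tl_subst tlL). Qed.

Lemma rm_refl x : R x x.
Proof.
apply: (rm_acc rmV) => a.
apply: (@sat_instance (□ Var 0 ⊃ Var 0) (fun=> a)).
by apply: S4L; apply: sub_gen_smallest; right; left.
Qed.

Lemma rm_trans y x z : R x y -> R y z -> R x z.
Proof.
move=> xy yz; apply: (rm_acc rmV) => a xa.
suff /(_ xa) h : sat V x (□ a) -> sat V x (□ □ a) by exact: h yz.
apply: (@sat_instance (□ Var 0 ⊃ □ □ Var 0) (fun=> a)).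
by apply: S4L; apply: sub_gen_smallest; right; right.
Qed.

(** By transitivity the points of a cluster have the same successors and the same predecessors, so
    only variables could distinguish them. *)
Lemma sat_cluster x y a : R x y -> R y x -> (forall i, V i x <-> V i y) ->
  sat V x a <-> sat V y a.
Proof.
move=> xy yx eqV; elim: a => [i||a IHa b IHb|a IHa|a IHa] //=.
- by rewrite IHa IHb.
- by split=> H u ?; apply: H; [exact: rm_trans xy _|exact: rm_trans yx _].
- split=> -[u ux ua]; exists u => //.
    exact: rm_trans ux xy.
  exact: rm_trans ux yx.
Qed.

Lemma rm_finite_cluster x : finite_set [set y | R x y /\ R y x].
Proof.
pose code (y : F) := [ffun i : 'I_s => `[< V i y >]].
(* [g] picks a cluster point for each truth assignment to the [s] variables, with default [x] for
   assignments not realised; the cluster lies in its image. *)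
have /choice[g gP] (e : {ffun 'I_s -> bool}) : exists z, forall y,
    R x y -> R y x -> code y = e -> [/\ R x z, R z x & code z = e].
  case: (pselect (exists y, [/\ R x y, R y x & code y = e])) => [[y h]|h].
    by exists y.
  by exists x => y xy yx yc; exfalso; apply: h; exists y.
apply: (@sub_finite_set _ _ (g @` setT)).
  move=> y [xy yx]; exists (code y) => //.
  have [xg gx /ffunP gc] := gP _ y xy yx erefl.
  apply: (rm_eq rmV) => a; apply: sat_cluster.
  - exact: rm_trans gx xy.
  - exact: rm_trans yx xg.
  - move=> i; have [si|si] := leqP s i.
      by split=> /(rm_var rmV si).
    have := gc (Ordinal si); rewrite !ffunE /= => gE.
    by split=> /asboolP h; apply/asboolP; move: h; rewrite gE.
exact/finite_image/finite_finset.
Qed.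

(** An antichain of [n.+1] points is described by formulas [chi i], which turn it into a refutation
    at [w] of a substitution instance of [bw M n]. *)
Lemma rm_width (M : form -> form) (S : F -> F -> Prop) (n : nat) (w : F) :
  (forall V' (u : F) a, sat V' u (M a) <-> exists2 v, S u v & sat V' v a) ->
  (forall u v, S u v -> R u v \/ R v u) ->
  L (bw M n) -> width_le R n [set u | S w u].
Proof.
move=> satM SR Lbw f wf; apply: contrapT => nR.
have nRf i j : i <= n -> j <= n -> i != j -> ~ R (f i) (f j).
  by move=> il jl ij Rij; apply: nR; exists i, j.
have /choice[a aP] (p : nat * nat) : exists b, p.1 <= n -> p.2 <= n ->
    p.1 != p.2 -> sat V (f p.1) (□ b) /\ ~ sat V (f p.2) b.
  case: p => i j /=; case: (pselect (R (f i) (f j))) => Rij.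
    by exists Bot => il jl ij; case: (nRf i j).
  have /existsNP[a /not_implyP[ia ja]] :
      ~ forall a, sat V (f i) (□ a) -> sat V (f j) a by move=> /(rm_acc rmV).
  by exists a.
(* By tightness [□ a (i, j)] holds at [f i] while [a (i, j)] fails at [f j]. Hence for [i != j] no
   world of [chi i] equals, sees or is seen by a world of [chi j]. *)
pose chi (i : nat) := \big[And/Top]_(j < n.+1 | i != j)
  (□ a (i, nat_of_ord j) ⊓ ¬ a (nat_of_ord j, i)).
have chiP (i j : nat) u : i <= n -> j <= n -> i != j -> sat V u (chi i) ->
    sat V u (□ a (i, j)) /\ ~ sat V u (a (j, i)).
  rewrite -(ltnS j) => il jl ij /sat_bigand h.
  have /sat_and[uij uji] : sat V u (□ a (i, j) ⊓ ¬ a (j, i)).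
    exact: (h (Ordinal jl)).
  by split.
have chi_sat i : i <= n -> sat V (f i) (chi i).
  move=> il; apply/sat_bigand => -[j jl] ij; apply/sat_and; rewrite /= in ij; split.
    by case: (aP (i, j)).
  by case: (aP (j, i)) => //=; rewrite eq_sym.
have [|i [j [il jl ij [u wu [ui ujv]]]]] :=
    sat_bw (satM _) (@sat_instance _ chi w Lbw).
  by move=> i il; exists (f i); [exact: wf|exact: chi_sat].
have [uij uji] := chiP i j u il jl ij ui.
have ji : j != i by rewrite eq_sym.
case: ujv => [uj|[v uv vj]].
  have [_ nuij] := chiP j i u jl il ji uj.
  by apply: nuij; apply: uij; exact: rm_refl.
have [vji vij] := chiP j i v jl il ji vj.
by case: (SR _ _ uv) => [/uij|/vji].
Qed.

Lemma bdSS j : bd j.+2 = (◇ (□ Var j.+1 ⊓ ¬ bd j.+1) ⊃ Var j.+1).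
Proof. by []. Qed.

Lemma rm_depth (k : nat) (A : set F) : 0 < k -> L (bd k) -> depth_le R k A.
Proof.
case: k => // k _ Lbd c _ cR.
have /choice[a aP] i : exists b, i < k.+1 ->
    sat V (c i) (□ b) /\ ~ sat V (c i.+1) b.
  case: (ltnP i k.+1) => [/cR[_ nRc]|]; last by exists Bot.
  have /existsNP[a /not_implyP[ia ja]] :
      ~ forall a, sat V (c i) (□ a) -> sat V (c i.+1) a by move=> /(rm_acc rmV).
  by exists a.
pose V' i := [set x | sat V x (a i)].
(* Under the definable valuation [V'], [bd] fails ever lower in the chain: [c j.+1] sees [c j],
   which satisfies [□ a j] and, for positive [j], refutes [bd j], while [a j] fails at [c j.+1]. *)
suff H j : j <= k -> ~ sat V' (c j.+1) (bd j.+1).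
  exact: (H k (leqnn k)) (sat_instance _ _ Lbd).
elim: j => [|j IHj] jk.
  have [c0 c1] := aP 0 isT.
  suff dia : sat V' (c 1) (◇ □ Var 0) by move=> /(_ dia).
  by apply/sat_dia; exists (c 0) => //; exact: (cR 0 isT).1.
have [cj cj1] := aP j.+1 jk; rewrite bdSS.
suff dia : sat V' (c j.+2) (◇ (□ Var j.+1 ⊓ ¬ bd j.+1)) by move=> /(_ dia).
apply/sat_dia; exists (c j.+1); first exact: (cR j.+1 jk).1.
by apply/sat_and; split=> //; apply: IHj; exact: ltnW.
Qed.

Lemma rm_locally_finite (k n m : nat) : 0 < k ->
  L (bd k) -> L (bw_plus n) -> L (bw_minus m) -> locally_finite F.
Proof.
move=> k0 Lbd Lbwp Lbwm w; split.
  apply: (finite_of_width_depth (n := n) (k := k) rm_finite_cluster).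
    apply: (rm_width _ _ Lbwp) => [V' u a|]; [exact: sat_dia|by left].
  exact: rm_depth.
apply: (finite_of_width_depth (n := m) (k := k) rm_finite_cluster).
  by apply: (rm_width (S := fun u v => R v u) _ _ Lbwm) => [V' u a|] //; right.
exact: rm_depth.
Qed.

Lemma isolating_formula (X : set F) (y : F) : finite_set X ->
  exists a, sat V y a /\ forall x, X x -> sat V x a -> x = y.
Proof.
have sep x : exists a, sat V y a /\ (sat V x a -> x = y).
  case: (pselect (x = y)) => [->|xy]; first by exists Top; split=> [/=|].
  have /existsNP[a xya] : ~ forall a, sat V x a <-> sat V y a.
    by move=> /(rm_eq rmV).
  case: (pselect (sat V y a)) => ya; [exists a|exists (¬ a)]; split=> //.
    by move=> xa; exfalso; apply: xya.
  by move=> /= nxa; exfalso; apply: xya; split.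
elim/finite_set_ind => [|z A [b [yb Ab]]]; first by exists Top; split=> [/=|//].
have [a [ya za]] := sep z; exists (a ⊓ b); split; first exact/sat_and.
by move=> x [->|Ax] /sat_and[xa xb]; [exact: za|exact: Ab].
Qed.

Lemma definable_trace (X S : set F) : finite_set X ->
  exists a, forall x, X x -> sat V x a <-> S x.
Proof.
(* [X] stays fixed as the set on which formulas must be correct, while [A] grows point by point up
   to [X]; each new point of [S] contributes its isolating formula as a disjunct. *)
move=> Xfin; suff /(_ X Xfin)[a aP] : forall A, finite_set A ->
    exists a, forall x, X x -> sat V x a <-> S x /\ A x.
  by exists a => x Xx; rewrite (aP x Xx); split=> [[]|].
move=> A; elim/finite_set_ind => [|z B [b bP]].
  by exists Bot => x _; split=> [//|[]].
have [d [zd dP]] := isolating_formula z Xfin.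
case: (pselect (S z)) => Sz.
  exists (d ⊔ b) => x Xx; rewrite sat_or (bP x Xx); split.
    by move=> [/(dP _ Xx)->|[Sx Bx]]; split=> //; [left|right].
  by move=> [Sx [->|Bx]]; [left|right].
exists b => x Xx; rewrite (bP x Xx); split=> [[Sx Bx]|[Sx [xz|Bx]]] //.
- by split=> //; right.
- by case: Sz; rewrite -xz.
Qed.

(* A formula only sees the finitely many worlds of [relevant w a], on which
   every valuation agrees with a definable one. *)
Lemma rm_valid (a : form) : locally_finite F -> L a -> valid F a.
Proof.
move=> lfin La V' w.
have [f fP] := choice (fun i => definable_trace (V' i) (finite_relevant w a lfin)).
by apply: (eq_sat _).1 (sat_instance f w La) => i x xw; exact: fP.
Qed.

End RefinedModel.

(** * Balls for zigzag distance and the axiom [bz] *)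

Section Ball.
Variable F : kframe.

Fixpoint ball (l : nat) (w : F) : set F :=
  if l is l'.+1 then
    ball l' w `|` \bigcup_(u in [set u | acc w u \/ acc u w]) ball l' u
  else [set w].

Lemma ball_center l w : ball l w w.
Proof. by elim: l => // l IHl; left. Qed.

(** [ball] prepends a step at the centre; here the step is appended at the far end. *)
Lemma ballS l w u v : ball l w u -> acc u v \/ acc v u -> ball l.+1 w v.
Proof.
elim: l w => [|l IHl] w; first by move=> -> uv; right; exists v.
move=> [wu uv|[x wx xu] uv]; first by left; exact: IHl uv.
by right; exists x => //; exact: IHl uv.
Qed.

Lemma finite_ball l w : locally_finite F -> finite_set (ball l w).
Proof.
move=> lfin; elim: l w => [|l IHl] w /=; first exact: finite_set1.
rewrite finite_setU; split=> //; apply: bigcup_finite => //.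
rewrite (_ : [set u | _] = [set u | acc w u] `|` [set u | acc u w]) //.
by rewrite finite_setU; have [] := lfin w.
Qed.

Lemma sat_iter_Delta V l w :
  sat V w (iter l Delta (Var 0)) <-> exists2 u, ball l w u & V 0 u.
Proof.
elim: l w => [|l IHl] w; first by split=> [Vw|[u ->]//]; exists w.
rewrite [iter _ _ _]/= /Delta !sat_or sat_dia; split.
  move=> [[/IHl[u wu Vu]|[x wx /IHl[u xu Vu]]]|[x xw /IHl[u xu Vu]]]; exists u => //.
  - by left.
  - by right; exists x => //; left.
  - by right; exists x => //; right.
move=> [u [wu|[x [wx|xw] xu]] Vu].
- by left; left; apply/IHl; exists u.
- by left; right; exists x => //; apply/IHl; exists u.
- by right; exists x => //; apply/IHl; exists u.
Qed.

(** Make [Var 0] true at [v] alone: [bz] then brings [v], at distance at most [l.+1] from [w],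
    within distance [l]. *)
Lemma ball_closed l w u v : valid F (bz (Some l)) -> ball l w u ->
  acc u v \/ acc v u -> ball l w v.
Proof.
move=> bzl wu uv; have wv := ballS wu uv.
suff /sat_iter_Delta[x wx <-] : sat (fun=> [set v]) w (iter l Delta (Var 0)).
  by [].
suff h : sat (fun=> [set v]) w (iter l.+1 Delta (Var 0)) by exact: bzl h.
by apply/sat_iter_Delta; exists v.
Qed.

End Ball.

(** * Subframes closed under successors and predecessors *)

Section GeneratedSubframe.
Variables (F : kframe) (C : set F) (w : F) (Cw : C w).
Hypothesis closedC : forall u v, C u -> acc u v \/ acc v u -> C v.

Definition subframe : kframe :=
  @KFrame {x : F | C x} (fun x y => acc (sval x) (sval y))
    (inhabits (exist _ w Cw)).

Lemma sat_subframe (V : nat -> set F) (V' : nat -> set subframe) (x : subframe) a :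
  (forall i y, V' i y <-> V i (sval y)) -> sat V' x a <-> sat V (sval x) a.
Proof.
move=> VV'; elim: a x => [i||a IHa b IHb|a IHa|a IHa] //= x.
- by rewrite IHa IHb.
- split=> [xa u xu|xa u xu]; last exact/IHa/xa.
  have Cu : C u by apply: closedC (svalP x) _; left.
  by apply/(IHa (exist _ u Cu)); exact: xa.
- split=> [[u ux /IHa ua]|[u ux ua]]; first by exists (sval u).
  have Cu : C u by apply: closedC (svalP x) _; right.
  by exists (exist _ u Cu) => //; apply/IHa.
Qed.

Lemma subframe_valid a : valid F a -> valid subframe a.
Proof.
move=> Fa V' x.
(* The valuation is carried over to [F] with every variable false outside [C]. *)
apply/(sat_subframe (V := fun i => [set u | exists y : subframe, sval y = u /\ V' i y])).
  move=> i y; split=> [V'y|[z [zy V'z]]]; first by exists y.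
  suff <- : z = y by [].
  by case: z y zy {V'z} => [z Cz] [y Cy] /= zy; exact: eq_exist.
exact: Fa.
Qed.

Lemma subframe_finite : finite_set C -> finite_set [set: subframe].
Proof.
move=> Cfin; have -> : [set: subframe] = (fun x : subframe => sval x) @^-1` C.
  by apply/seteqP; split=> // x _; exact: svalP.
apply: finite_preimage => // -[x Cx] [y Cy] _ _ /= xy; exact: eq_exist.
Qed.

End GeneratedSubframe.

(** * Countermodels and the two conclusions *)

Lemma log_of_countermodels (L : set form) (C : set kframe) :
  (forall F a, C F -> L a -> valid F a) ->
  (forall a, ~ L a -> exists2 F, C F & ~ valid F a) -> L = Log C.
Proof.
move=> sound complete; apply/seteqP; split=> [a La F CF|a Ca]; first exact: sound.
by apply: contrapT => /complete[F /Ca].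
Qed.

(** Stated for any [l], including ω, so that it serves both completeness and the finite model
    property. *)
Lemma exists_locally_finite_countermodel (k n m : nat) (l : option nat)
    (L : set form) (a : form) :
  0 < k -> NExt (S4BP k l n m) L -> ~ L a ->
  exists F, [/\ locally_finite F, forall b, L b -> valid F b & ~ valid F a].
Proof.
move=> k0 [tlL S4BPL] La.
have [F [V [w [rmV wa]]]] := exists_refined_model tlL La.
have S4L : S4t `<=` L by move=> b S4b; apply: S4BPL; apply: sub_gen_smallest; left.
have lfin : locally_finite F.
  apply: (rm_locally_finite tlL S4L rmV (k := k) (n := n) (m := m)) => //;
    apply: S4BPL; apply: sub_gen_smallest; right.
  - by left; left; left.
  - by left; right.
  - by right.
exists F; split=> [//|b Lb|Fa]; first exact: (rm_valid tlL rmV).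
exact: wa (Fa V w).
Qed.

Theorem theorem4p9 (n m k l : nat)
    (hn : 0 < n) (hm : 0 < m) (hk : 0 < k) (hl : 0 < l)
    (L : set form) (hL : NExt (S4BP k None n m) L) :
  kripke_complete L /\
  (NExt (S4BP k (Some l) n m) L -> finite_model_property L).
Proof.
split.
  exists [set F | forall a, L a -> valid F a].
  apply: log_of_countermodels => [F a LF|a La]; first exact: LF.
  have [F [_ LF Fa]] := exists_locally_finite_countermodel hk hL La.
  by exists F.
move=> hLl.
exists [set F | finite_set [set: world F] /\ forall a, L a -> valid F a].
  by move=> F [].
apply: log_of_countermodels => [F a [_ LF]|a La]; first exact: LF.
have [F [lfin LF Fa]] := exists_locally_finite_countermodel hk hLl La.
have /existsNP[V /existsNP[w wa]] := Fa.
have bzF : valid F (bz (Some l)).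
  by apply: LF; apply: hLl.2; apply: sub_gen_smallest; right; left; left; right.
have closed u v := @ball_closed F l w u v bzF.
(* The ball around the refuting world [w] is finite by local finiteness and closed in both
   directions by [bz], so restricting to it keeps the validity of [L] and the failure of [a] at
   [w]. *)
exists (subframe (ball_center l w)).
  split=> [|b /LF]; first exact/subframe_finite/finite_ball.
  exact: subframe_valid.
move=> Ga; apply: wa.
pose x : subframe (ball_center l w) := exist _ w (ball_center l w).
pose V' i : set (subframe (ball_center l w)) := [set y | V i (sval y)].
have V'V i y : V' i y <-> V i (sval y) by [].
exact: (sat_subframe closed x a V'V).1 (Ga V' x).
Qed.
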